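(* Let $A \in M_n(\mathbb{C})$ be diagonalizable and $R_n$-normal. Then there exists a perplectic matrix $P \in GL_n(\mathbb{C})$ such that $P^\star A P$ is a matrix in $X$-form.
   Context: $M_n(\mathbb{C})$ is the set of complex $n\times n$ matrices, $GL_n(\mathbb{C})$ the nonsingular ones, and $^H$ denotes conjugate transpose. $R_n\in GL_n(\mathbb{R})$ is the $n\times n$ matrix with ones on the anti-diagonal and zeros elsewhere. For $A\in M_n(\mathbb{C})$ put $A^\star := R_n^{-1}A^HR_n = R_nA^HR_n$. $A$ is called $R_n$-normal if $AA^\star = A^\star A$. $P\in M_n(\mathbb{C})$ is called perplectic if $P^HR_nP=R_n$ (equivalently, $P$ is invertible and $P^\star=P^{-1}$). Diagonalizable means similar over $\mathbb{C}$ to a diagonal matrix. $X$-form: for $n=2m$ even, a matrix in $M_n(\mathbb{C})$ is in $X$-form if it equals $\begin{bmatrix} D_{11} & R_mD_{12}\\ R_mD_{21} & D_{22}\end{bmatrix}$ with diagonal $D_{11},D_{12},D_{21},D_{22}\in M_m(\mathbb{C})$. For $n=2m+1$ odd, a matrix in $M_n(\mathbb{C})$ is in $X$-form if it equals $\begin{bmatrix} D_{11} & 0 & R_mD_{12}\\ 0&\alpha&0\\ R_mD_{21} & 0 & D_{22}\end{bmatrix}$ with such diagonal $D_{ij}\in M_m(\mathbb{C})$ and some $\alpha\in\mathbb{C}$. That is, all nonzero entries lie on the diagonal or the anti-diagonal. *)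

(* Defs.v *)
From mathcomp Require Import all_boot all_order all_algebra.
From mathcomp Require Import complex reals.
From mathcomp Require Import zify.

Set Implicit Arguments.
Unset Strict Implicit.
Unset Printing Implicit Defensive.

Import GRing.Theory Num.Theory.
Local Open Scope ring_scope.
Local Open Scope sesquilinear_scope.

Section PerplecticDefinitions.
Context {C : numClosedFieldType}.

Definition flip_mx n : 'M[C]_n := \matrix_(i, j) (j == rev_ord i)%:R.

(* [A ^t*] is the conjugate transpose; [star] is the adjoint for the Hermitian
   form of matrix [flip_mx n]. *)
Definition star n (A : 'M[C]_n) : 'M[C]_n :=
  invmx (flip_mx n) *m A ^t* *m flip_mx n.

Definition flip_normal n (A : 'M[C]_n) : Prop :=
  A *m star A = star A *m A.

Definition perplectic n (P : 'M[C]_n) : Prop :=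
  P ^t* *m flip_mx n *m P = flip_mx n.

(* The size is an index of the family, so that an arbitrary ['M_n] is in X-form
   only through an equation [n = m + m] or [n = m + (1 + m)]; [X_formP] gives
   the entrywise description, which does not mention the block sizes. *)
Variant X_form : forall n, 'M[C]_n -> Prop :=
| X_form_even m (D11 D12 D21 D22 : 'M[C]_m) of
    is_diag_mx D11 & is_diag_mx D12 & is_diag_mx D21 & is_diag_mx D22 :
    X_form (block_mx D11 (flip_mx m *m D12)
                     (flip_mx m *m D21) D22)
| X_form_odd m (D11 D12 D21 D22 : 'M[C]_m) (alpha : C) of
    is_diag_mx D11 & is_diag_mx D12 & is_diag_mx D21 & is_diag_mx D22 :
    X_form (block_mx D11 (row_mx (0 : 'M_(m, 1)) (flip_mx m *m D12))
                     (col_mx (0 : 'M_(1, m)) (flip_mx m *m D21))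
                     (block_mx (alpha%:M : 'M_1) 0 0 D22)).

Lemma mul_flip_mxE m n (B : 'M[C]_(m, n)) i j :
  (flip_mx m *m B) i j = B (rev_ord i) j.
Proof.
rewrite mxE (bigD1 (rev_ord i)) //= mxE eqxx mul1r big1 ?addr0 // => k ki.
by rewrite mxE (negPf ki) mul0r.
Qed.

Lemma flip_mxK n : flip_mx n *m flip_mx n = 1%:M.
Proof.
by apply/matrixP => i j; rewrite mul_flip_mxE !mxE rev_ordK eq_sym.
Qed.

Lemma invmx_flip n : invmx (flip_mx n) = flip_mx n.
Proof.
have [u _] := mulmx1_unit (flip_mxK n).
by rewrite -[LHS]mulmx1 -(flip_mxK n) mulKmx.
Qed.

Lemma X_formP n (A : 'M[C]_n) :
  X_form A <-> forall i j, j != i -> j != rev_ord i -> A i j = 0.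
Proof.
split.
  case: {n A} _ / => [m D11 D12 D21 D22 | m D11 D12 D21 D22 a]
    /is_diag_mxP h11 /is_diag_mxP h12 /is_diag_mxP h21 /is_diag_mxP h22 i j;
    rewrite -!val_eqE.
    case: (split_ordP i) => i' ->; case: (split_ordP j) => j' -> /=;
      rewrite ?block_mxEul ?block_mxEur ?block_mxEdl ?block_mxEdr
              ?mul_flip_mxE => h1 h2; move: (ltn_ord i') (ltn_ord j');
      [move=> ? ?; apply: h11 | move=> ? ?; apply: h12
      |move=> ? ?; apply: h21 | move=> ? ?; apply: h22] => /=; lia.
  case: (split_ordP i) => i' ->; case: (split_ordP j) => j' -> /=;
    rewrite ?block_mxEul ?block_mxEur ?block_mxEdl ?block_mxEdr => h1 h2.
  - by apply: h11; lia.
  - case: (split_ordP j') h1 h2 => k -> /=;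
      rewrite ?row_mxEl ?row_mxEr ?mul_flip_mxE ?mxE // => h1 h2.
    by apply: h12 => /=; move: (ltn_ord i') (ltn_ord k); lia.
  - case: (split_ordP i') h1 h2 => k -> /=;
      rewrite ?col_mxEu ?col_mxEd ?mul_flip_mxE ?mxE // => h1 h2.
    by apply: h21 => /=; move: (ltn_ord k) (ltn_ord j'); lia.
  - case: (split_ordP i') h1 h2 => k ->; case: (split_ordP j') => l -> /=;
      rewrite ?block_mxEul ?block_mxEur ?block_mxEdl ?block_mxEdr => h1 h2;
      rewrite ?mxE //.
      by move: h1; rewrite !ord1 eqxx.
    by apply: h22; lia.
have [m nE] : {m | n = m + m \/ n = m + (1 + m)}%N by exists n./2; lia.
case: nE => nE; subst n => hA.
  rewrite -(submxK A) -[ursubmx A]mul1mx -[dlsubmx A]mul1mx -flip_mxK -!mulmxA.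
  by apply: X_form_even; apply/is_diag_mxP => i j ij;
    rewrite ?mul_flip_mxE !mxE; apply: hA; rewrite -val_eqE /=;
    move: (ltn_ord i) (ltn_ord j); lia.
have -> : A = block_mx (ulsubmx A)
    (row_mx (0 : 'M_(m, 1))
            (flip_mx m *m (flip_mx m *m rsubmx (ursubmx A))))
    (col_mx (0 : 'M_(1, m))
            (flip_mx m *m (flip_mx m *m dsubmx (dlsubmx A))))
    (block_mx (drsubmx A (lshift m ord0) (lshift m ord0))%:M 0 0
              (drsubmx (drsubmx A))).
  rewrite -[LHS]submxK !mulmxA !flip_mxK !mul1mx.
  rewrite -[ursubmx A in LHS]hsubmxK -[dlsubmx A in LHS]vsubmxK.
  rewrite -[drsubmx A in LHS]submxK.
  congr (block_mx _ (row_mx _ _) (col_mx _ _) (block_mx _ _ _ _));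
    apply/matrixP => i j; rewrite ?mxE ?ord1 ?mulr1n //; apply: hA;
    rewrite -val_eqE /=; move: (ltn_ord i) (ltn_ord j); lia.
by apply: X_form_odd; apply/is_diag_mxP => i j ij;
  rewrite ?mul_flip_mxE !mxE; apply: hA; rewrite -val_eqE /=;
  move: (ltn_ord i) (ltn_ord j); lia.
Qed.

End PerplecticDefinitions.

(* Main.v *)
Require Import Defs.
From mathcomp Require Import all_boot all_order all_algebra.
From mathcomp Require Import all_fingroup.
From mathcomp Require Import complex reals.
From mathcomp Require Import zify ring.

(** Let [x, y] = x^H R y be the Hermitian form of the flip matrix R, for which
    the star is the adjoint.  A diagonalizable normal A and its adjoint commute
    and are both diagonalizable, so they share a basis of eigenvectors v_i, with
    eigenvalues d_i and e_i.  The Gram matrix G of this basis satisfies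
    D^H G = G E for D = diag d, E = diag e; that is, v_i and v_j can be
    non-orthogonal only if conj d_i = e_j.  Everything reduces to such triples
    (G, d, e) ([eigen_gram]).

    A perplectic basis in which A is in X-form is a basis of hyperbolic pairs
    (x, y), [x, x] = [y, y] = 0 and [x, y] = 1, each spanning an A-invariant
    plane, plus one vector of norm 1 when n is odd.  Such a basis is found by
    splitting off one invariant hyperbolic plane at a time
    ([splits_planeP], [eigen_gram_X_reducible]).

    - If conj d_i <> e_i for some i, then v_i is isotropic, and so is any v_j
      that is not orthogonal to it, because conj d_j = e_i differs from
      e_j = conj d_i.  So v_i and v_j span a hyperbolic plane
      ([splits_plane_isotropic]).
    - If conj d_i = e_i for all i, then E = D^H, so G commutes with D and both
      are diagonalized by one unitary matrix.  The form being indefinite, there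
      are then orthogonal eigenvectors u, v of positive and negative norm, and
      they span a hyperbolic plane ([splits_plane_diag]).

    In both cases the block elimination that makes the remaining basis vectors
    orthogonal to the plane commutes with D and E, so they remain eigenvectors
    ([splits_plane_lead]).

    Indefiniteness has to survive the passage to the orthogonal complement.
    Instead of Witt cancellation, the induction carries upper bounds on the
    dimension of positive and of negative definite subspaces
    ([split_inertia]).  They hold for R since it is nonpositive, resp.
    nonnegative, on coordinate subspaces, and each drops by one when a
    hyperbolic plane is removed: a positive vector of the plane can be added to
    any positive definite subspace of the complement. *)

Set Implicit Arguments.
Unset Strict Implicit.
Unset Printing Implicit Defensive.

Import Order.TTheory GRing.Theory Num.Theory.
Local Open Scope ring_scope.
Local Open Scope sesquilinear_scope.

Section FlipNormal.
Context {C : numClosedFieldType}.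

(** * Conjugate transposes *)

Lemma trCmx_mul m n p (A : 'M[C]_(m, n)) (B : 'M[C]_(n, p)) :
  (A *m B)^t* = B^t* *m A^t*.
Proof. by rewrite trmx_mul map_mxM. Qed.

Lemma trCmx_block m1 m2 n1 n2 (A : 'M[C]_(m1, n1)) B (D : 'M[C]_(m2, n1)) E :
  (block_mx A B D E : 'M_(m1 + m2, n1 + n2)) ^t* =
  block_mx (A^t*) (D^t*) (B^t*) (E^t*).
Proof. by rewrite tr_block_mx map_block_mx. Qed.

Lemma trCmx0 m n : (0 : 'M[C]_(m, n))^t* = 0.
Proof. by rewrite trmx0 map_mx0. Qed.

Lemma trCmx_scalar n (a : C) : (a%:M : 'M[C]_n)^t* = (a^*)%:M.
Proof. by rewrite tr_scalar_mx map_scalar_mx. Qed.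

Lemma trCmx_flip n : (flip_mx n : 'M[C]_n)^t* = flip_mx n.
Proof.
apply/matrixP => i j; rewrite !mxE conjC_nat.
by rewrite -[i in LHS]rev_ordK (inj_eq rev_ord_inj) eq_sym.
Qed.

(** * Bounds on the dimension of positive definite subspaces *)

Definition posdef n (G : 'M[C]_n) :=
  forall v : 'cV_n, v != 0 -> 0 < (v^t* *m G *m v) 0 0.

(** The subspaces are given as column spaces; positive definiteness of the
    restricted form makes the columns of [W] independent. *)
Definition pos_index_le N n (G : 'M[C]_n) :=
  forall r (W : 'M[C]_(n, r)), posdef (W^t* *m G *m W) -> (r <= N)%N.

Lemma pos_index_le_congr N n (G S : 'M[C]_n) :
  pos_index_le N G -> pos_index_le N (S^t* *m G *m S).
Proof.
by move=> hG r W hW; apply: (hG r (S *m W)); rewrite trCmx_mul !mulmxA in hW *.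
Qed.

Lemma wide_mx_kernel N r (M : 'M[C]_(N, r)) : (N < r)%N ->
  exists2 v : 'cV_r, v != 0 & M *m v = 0.
Proof.
move=> Nr; have : kermx M^T != 0.
  rewrite -mxrank_eq0 mxrank_ker subn_eq0 -ltnNge.
  by rewrite (leq_ltn_trans _ Nr) // rank_leq_col.
case/rowV0Pn => v /sub_kermxP vM v0; exists v^T; first by rewrite trmx_eq0.
by rewrite -[M]trmxK -trmx_mul vM trmx0.
Qed.

(** A positive definite subspace meets the kernel of [X], on which the form is
    nonpositive, only in 0, and that kernel has codimension at most [N]. *)
Lemma pos_index_leP N n (G : 'M[C]_n) (X : 'M[C]_(N, n)) :
  (forall u : 'cV_n, X *m u = 0 -> (u^t* *m G *m u) 0 0 <= 0) ->
  pos_index_le N G.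
Proof.
move=> hX r W hW; rewrite leqNgt; apply/negP => Nr.
have [v v0] := wide_mx_kernel (X *m W) Nr; rewrite -mulmxA => /hX.
rewrite trCmx_mul !mulmxA => hv.
by have := lt_le_trans (hW v v0); rewrite !mulmxA => /(_ _ hv); rewrite ltxx.
Qed.

Lemma posdef_diag n (g : 'rV[C]_n) : (forall i, 0 < g 0 i) -> posdef (diag_mx g).
Proof.
move=> g0 v v0; have /cV0Pn[i vi] := v0.
rewrite mxE (bigD1 i) //= ltr_wpDr //.
  apply: sumr_ge0 => j _; rewrite mul_mx_diag !mxE mulrAC.
  by rewrite mulr_ge0 ?(ltW (g0 j)) // mulrC mul_conjC_ge0.
by rewrite mul_mx_diag !mxE mulrAC mulr_gt0 // mulrC mul_conjC_gt0.
Qed.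

Lemma posdef_block p q (K : 'M[C]_p) (M : 'M[C]_q) :
  posdef K -> posdef M -> posdef (block_mx K 0 0 M).
Proof.
move=> hK hM v; rewrite -[v]vsubmxK => v0.
rewrite tr_col_mx map_row_mx mul_row_block !mulmx0 addr0 add0r mul_row_col.
rewrite mxE.
have psd k (H : 'M[C]_k) (u : 'cV_k) :
    posdef H -> 0 <= (u^t* *m H *m u) 0 0.
  move=> hH; have [->|u0] := eqVneq u 0; last exact: ltW (hH u u0).
  by rewrite mulmx0 mxE.
have [u0|u0] := eqVneq (usubmx v) 0.
  rewrite ltr_wpDl ?psd //; apply: hM.
  by apply: contra_neq v0 => ->; rewrite u0 col_mx0.
by rewrite ltr_wpDr ?psd //; apply: hK.
Qed.

(** A vector [c] of positive norm in the first summand can be adjoined to every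
    positive definite subspace of the second one. *)
Lemma pos_index_le_block N p q (K : 'M[C]_p) (M : 'M[C]_q) (c : 'cV[C]_p) :
  0 < (c^t* *m K *m c) 0 0 -> pos_index_le N.+1 (block_mx K 0 0 M) ->
  pos_index_le N M.
Proof.
move=> hc hG r W hW; apply: (hG (1 + r)%N (block_mx c 0 0 W)).
rewrite trCmx_block !trCmx0 !mulmx_block !(mul0mx, mulmx0, addr0, add0r).
apply: posdef_block => //.
rewrite [_ *m c]mx11_scalar => v v0; rewrite mul_mx_scalar -scalemxAl mxE.
have := @posdef_diag 1 (const_mx 1) _ v v0; rewrite diag_const_mx mulmx1.
by move=> h; rewrite mulr_gt0 // h // => i; rewrite mxE ltr01.
Qed.

(** These are the bounds attained by the flip form, of signature
    (uphalf n, n./2). *)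
Definition split_inertia n (G : 'M[C]_n) :=
  pos_index_le (uphalf n) G /\ pos_index_le n./2 (- G).

Lemma split_inertia_congr n (G S : 'M[C]_n) :
  split_inertia G -> split_inertia (S^t* *m G *m S).
Proof.
move=> [hp hn]; split; first exact: pos_index_le_congr.
by rewrite -mulNmx -mulmxN; apply: pos_index_le_congr.
Qed.

(** The form vanishes on the vectors supported on the first [n./2] coordinates;
    on those supported on the first [uphalf n] ones only the square of the middle
    coordinate, if any, remains. *)
Lemma split_inertia_flip n : split_inertia (flip_mx n : 'M[C]_n).
Proof.
have quad (u : 'cV[C]_n) :
    (u^t* *m flip_mx n *m u) 0 0 = \sum_i (u i 0)^* * u (rev_ord i) 0.
  by rewrite -mulmxA mxE; apply: eq_bigr => i _; rewrite mul_flip_mxE !mxE.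
(* [X N] extracts the last [N] coordinates. *)
pose X N : 'M[C]_(N, n) := \matrix_(i, j) (val j == (n - N + i)%N)%:R.
have XP N (u : 'cV[C]_n) (i : 'I_n) :
    X N *m u = 0 -> (n - N <= i)%N -> u i 0 = 0.
  move=> Xu Ni; have iN : (i - (n - N) < N)%N by case: i Ni => i /=; lia.
  move/matrixP/(_ (Ordinal iN) 0): Xu; rewrite !mxE (bigD1 i) //= mxE /=.
  rewrite subnKC // eqxx mul1r big1 ?addr0 // => j; rewrite -val_eqE => ji.
  by rewrite mxE /= subnKC // (negPf ji) mul0r.
split; apply: (@pos_index_leP _ _ _ (X _)) => u Xu.
  rewrite quad big1 // => i _.
  have [ni|ni] := leqP (n - uphalf n) i.
    by rewrite (XP _ _ _ Xu ni) conjC0 mul0r.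
  by rewrite (XP _ _ (rev_ord i) Xu) ?mulr0 //=; move: (ltn_ord i); lia.
rewrite mulmxN mulNmx mxE quad oppr_le0 sumr_ge0 // => i _.
have [ni|ni] := leqP (n - n./2) i.
  by rewrite (XP _ _ _ Xu ni) conjC0 mul0r.
have [nj|nj] := leqP (n - n./2) (rev_ord i).
  by rewrite (XP _ _ _ Xu nj) mulr0.
have -> : rev_ord i = i.
  by apply: val_inj; move: nj => /=; move: (ltn_ord i); lia.
by rewrite mulrC mul_conjC_ge0.
Qed.

(** * Assembling hyperbolic planes into an X-form *)

(** In the basis [T] the form becomes the flip form and the operator [D] has
    matrix [B]. *)
Definition X_reducible n (G D : 'M[C]_n) :=
  exists T B : 'M_n,
    [/\ T^t* *m G *m T = flip_mx n, D *m T = T *m B & X_form B].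

Lemma X_reducible_congr n (G D S D' : 'M[C]_n) :
  D *m S = S *m D' -> X_reducible (S^t* *m G *m S) D' -> X_reducible G D.
Proof.
move=> DS [T [B [TG DT XB]]]; exists (S *m T), B; split=> //.
  by rewrite trCmx_mul !mulmxA in TG *.
by rewrite mulmxA DS -!mulmxA DT.
Qed.

(** The two vectors of the plane listed first move to both ends, so that they
    are swapped by [rev_ord]. *)
Lemma hyperbolic_perm k : exists s : 'S_(2 + k),
  forall i, s i = (if i == 0 :> nat then 0 else
                   if i == k.+1 :> nat then 1 else i.+1)%N :> nat.
Proof.
pose f (i : nat) := (if i == 0 then 0 else if i == k.+1 then 1 else i.+1)%N.
have fP (i : 'I_(2 + k)) : (f i < 2 + k)%N.
  by rewrite /f; case: i => i /= ?; do 2?case: ifP => ?; lia.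
have f_inj : injective (fun i => Ordinal (fP i)).
  move=> [i hi] [j hj] /(congr1 val) /=; rewrite /f => h; apply: val_inj => /=.
  by move: h; do 4?case: ifP => ?; lia.
by exists (perm f_inj) => i; rewrite permE.
Qed.

Lemma gram_perm n (s : 'S_n) (G : 'M[C]_n) :
  (perm_mx s^-1)^t* *m G *m perm_mx s^-1 = row_perm s (col_perm s G).
Proof.
by rewrite -mulmxA -col_permE tr_perm_mx map_perm_mx invgK -row_permE.
Qed.

(** Every 2 x 2 matrix is in X-form, hence [D2] is unconstrained. *)
Lemma X_reducible_hyperbolic k (D2 : 'M[C]_2) (Dk : 'M[C]_k) :
  X_form Dk ->
  X_reducible (block_mx (flip_mx 2) 0 0 (flip_mx k)) (block_mx D2 0 0 Dk).
Proof.
move=> /X_formP Xk; have [s sE] := hyperbolic_perm k.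
set G := block_mx _ _ _ _; set D := block_mx _ _ _ _.
have entry (H1 : 'M[C]_2) (H2 : 'M[C]_k) i j :
    row_perm s (col_perm s (block_mx H1 0 0 H2)) i j =
    block_mx H1 0 0 H2 (s i) (s j) by rewrite !mxE.
exists (perm_mx s^-1), (row_perm s (col_perm s D)); split.
- rewrite gram_perm; apply/matrixP => i j; rewrite entry [RHS]mxE -val_eqE /=.
  have := sE i; have := sE j.
  case: (split_ordP (s i)) => i' ->; case: (split_ordP (s j)) => j' -> /=;
    rewrite ?block_mxEul ?block_mxEur ?block_mxEdl ?block_mxEdr ?mxE -?val_eqE /=;
    move: (ltn_ord i') (ltn_ord j') (ltn_ord i) (ltn_ord j);
    do 4?case: ifP => ?; move=> ? ? ? ? ? ?; try (congr (_%:R); lia);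
    by case: eqP => //; lia.
- by rewrite row_permE col_permE !mulmxA -perm_mxM mulVg perm_mx1 mul1mx.
apply/X_formP => i j; rewrite entry -!val_eqE /=.
have := sE i; have := sE j.
case: (split_ordP (s i)) => i' ->; case: (split_ordP (s j)) => j' -> /=;
  rewrite ?block_mxEul ?block_mxEur ?block_mxEdl ?block_mxEdr ?mxE //;
  move: (ltn_ord i') (ltn_ord j') (ltn_ord i) (ltn_ord j);
  do 4?case: ifP => ?; move=> ? ? ? ? ? ? ? ?; try (exfalso; lia);
  apply: Xk; rewrite -val_eqE /=; lia.
Qed.

Lemma X_reducible_block k (K C0 D2 : 'M[C]_2) (M Dk : 'M[C]_k) :
  C0^t* *m K *m C0 = flip_mx 2 -> X_reducible M Dk ->
  X_reducible (block_mx K 0 0 M) (block_mx D2 0 0 Dk).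
Proof.
move=> hK [T [B [TM DT XB]]].
have C0u : C0 \in unitmx.
  have : flip_mx 2 *m (C0^t* *m K) *m C0 = 1%:M.
    by rewrite -mulmxA hK flip_mxK.
  by case/mulmx1_unit.
apply: (@X_reducible_congr _ _ _ (block_mx C0 0 0 T)
          (block_mx (invmx C0 *m D2 *m C0) 0 0 B)).
  rewrite !mulmx_block !(mul0mx, mulmx0, addr0, add0r) DT.
  by rewrite !mulmxA mulmxV // mul1mx.
rewrite trCmx_block !trCmx0 !mulmx_block !(mul0mx, mulmx0, addr0, add0r) hK TM.
exact: X_reducible_hyperbolic.
Qed.

(** * Gram matrices of eigenbases *)

(** [G] is the Gram matrix of a basis of common eigenvectors of an operator and
    its adjoint, with eigenvalues [d] and [e]; [eigen_gram_adj] is the adjunction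
    [[A x, y] = [x, A^* y]] in that basis. *)
Record eigen_gram n (G : 'M[C]_n) (d e : 'rV[C]_n) : Prop := EigenGram {
  eigen_gram_herm : G^t* = G;
  eigen_gram_unit : G \in unitmx;
  eigen_gram_inertia : split_inertia G;
  eigen_gram_adj : (diag_mx d)^t* *m G = G *m diag_mx e }.

Lemma eigen_gram_congr n (G S : 'M[C]_n) (d e d' e' : 'rV[C]_n) :
  eigen_gram G d e -> S \in unitmx ->
  diag_mx d *m S = S *m diag_mx d' -> diag_mx e *m S = S *m diag_mx e' ->
  eigen_gram (S^t* *m G *m S) d' e'.
Proof.
case=> Gh Gu Gi Ga Su dS eS; split.
- by rewrite !trCmx_mul trmxCK Gh mulmxA.
- by rewrite !unitmx_mul Su Gu map_unitmx unitmx_tr Su.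
- exact: split_inertia_congr.
rewrite !mulmxA -trCmx_mul -dS trCmx_mul -!mulmxA -eS; congr (_ *m _).
by rewrite !mulmxA Ga.
Qed.

Lemma eigen_gram_entry n (G : 'M[C]_n) d e i j :
  eigen_gram G d e -> G i j != 0 -> (d 0 i)^* = e 0 j.
Proof.
case=> _ _ _ /matrixP/(_ i j); rewrite tr_diag_mx map_diag_mx mul_diag_mx.
by rewrite mul_mx_diag !mxE mulrC => h G0; apply: (mulfI G0).
Qed.

Lemma eigen_gram_conj n (G : 'M[C]_n) d e i j :
  eigen_gram G d e -> G i j = (G j i)^*.
Proof. by case=> /matrixP/(_ i j) <- _ _ _; rewrite !mxE. Qed.

(** The inertia bounds pass to the complement because a hyperbolic plane has
    vectors of norm 2 and -2, namely (1, 1) and (1, -1) in a hyperbolic basis. *)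
Lemma eigen_gram_drsub k (K C0 : 'M[C]_2) (M : 'M[C]_k) d e :
  C0^t* *m K *m C0 = flip_mx 2 -> eigen_gram (block_mx K 0 0 M) d e ->
  eigen_gram M (rsubmx d) (rsubmx e).
Proof.
move=> hK [Gh Gu [Gp Gn] Ga].
pose c (eps : C) := \col_(i < 2) (if i == 0 then 1 else eps).
have quad eps : ((C0 *m c eps)^t* *m K *m (C0 *m c eps)) 0 0 = eps + eps^*.
  have -> : (C0 *m c eps)^t* *m K *m (C0 *m c eps) =
            (c eps)^t* *m (flip_mx 2 *m c eps).
    by rewrite trCmx_mul -hK !mulmxA.
  rewrite mxE !big_ord_recl big_ord0 !mul_flip_mxE !mxE /=.
  by rewrite conjC1 mul1r mulr1 addr0.
split.
- by move: Gh; rewrite trCmx_block => /eq_block_mx[].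
- move: Gu; rewrite !unitmxE det_ublock unitrM.
  by case/andP.
- split.
    apply: (@pos_index_le_block _ _ _ _ _ (C0 *m c 1) _ Gp).
    by rewrite quad conjC1 addr_gt0 ?ltr01.
  move: Gn; rewrite opp_block_mx !oppr0 => Gn.
  apply: (@pos_index_le_block _ _ _ _ _ (C0 *m c (-1)) _ Gn).
  by rewrite mulmxN mulNmx mxE quad rmorphN1 opprD opprK addr_gt0 ?ltr01.
move: Ga; rewrite -{1}[d]hsubmxK -{1}[e]hsubmxK !diag_mx_row trCmx_block.
by rewrite !trCmx0 !mulmx_block !(mul0mx, mulmx0, addr0, add0r) => /eq_block_mx[].
Qed.

(** * Splitting off an invariant hyperbolic plane *)

(** The new basis [S] still consists of common eigenvectors; its first two
    vectors span a hyperbolic plane orthogonal to the others, whose Gram matrix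
    is [M]. *)
Definition splits_plane k (G : 'M[C]_(2 + k)) (d e : 'rV[C]_(2 + k)) :=
  exists S K M C0 d' e',
    [/\ S \in unitmx, diag_mx d *m S = S *m diag_mx d',
        diag_mx e *m S = S *m diag_mx e',
        S^t* *m G *m S = block_mx K 0 0 M & C0^t* *m K *m C0 = flip_mx 2].

Lemma splits_plane_congr k (G S : 'M[C]_(2 + k)) d e d' e' :
  S \in unitmx -> diag_mx d *m S = S *m diag_mx d' ->
  diag_mx e *m S = S *m diag_mx e' ->
  splits_plane (S^t* *m G *m S) d' e' -> splits_plane G d e.
Proof.
move=> Su dS eS [S' [K [M [C0 [d2 [e2 [S'u dS' eS' GE KE]]]]]]].
exists (S *m S'), K, M, C0, d2, e2; split=> //.
- by rewrite unitmx_mul Su.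
- by rewrite mulmxA dS -mulmxA dS' mulmxA.
- by rewrite mulmxA eS -mulmxA eS' mulmxA.
by rewrite trCmx_mul -GE !mulmxA.
Qed.

Lemma perm_through (T : finType) (x y a b : T) : x != y -> a != b ->
  exists s : {perm T}, s x = a /\ s y = b.
Proof.
move=> xy ab; pose b' := tperm x a b.
have xb' : x != b'.
  by rewrite -[x in x != _](tpermR x a) (inj_eq perm_inj).
exists (tperm y b' * tperm x a)%g; rewrite !permM; split.
  by rewrite (@tpermD _ y b') 1?eq_sym // tpermL.
by rewrite tpermL tpermK.
Qed.

Lemma diag_mx_perm n (s : 'S_n) (d : 'rV[C]_n) :
  diag_mx d *m perm_mx s^-1 = perm_mx s^-1 *m diag_mx (col_perm s d).
Proof.
rewrite -col_permE -row_permE; apply/matrixP => i j.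
by rewrite !mxE permKV -[_ == j](inj_eq (@perm_inj _ s)) permKV.
Qed.

(** Block elimination makes the other basis vectors orthogonal to the first two.
    It preserves the eigenvectors because it commutes with [diag_mx d] and
    [diag_mx e]: with [K] the leading block and [U] the one to its right,
    adjunction gives [K D1 = E1^H K] and [E1^H U = U D2], whence
    [D1 (K^-1 U) = (K^-1 U) D2], and likewise for [e]. *)
Lemma splits_plane_lead k (G : 'M[C]_(2 + k)) d e C0 :
  C0^t* *m ulsubmx G *m C0 = flip_mx 2 -> eigen_gram G d e ->
  splits_plane G d e.
Proof.
move=> KE GG; have [Gh _ _ Ga] := GG.
have Ku : ulsubmx G \in unitmx.
  have : C0^t* *m ulsubmx G *m (C0 *m flip_mx 2) = 1%:M.
    by rewrite mulmxA KE flip_mxK.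
  rewrite -mulmxA => /mulmx1_unit[_].
  by rewrite !unitmx_mul => /andP[].
set K := ulsubmx G in KE Ku *; set U := ursubmx G.
have GE : G = block_mx K U (U^t*) (drsubmx G).
  rewrite -{1}[G]submxK; congr block_mx.
  by move: Gh; rewrite -{1 2}[G]submxK trCmx_block => /eq_block_mx[_ _ ->].
have Kh : K^t* = K by move: Gh; rewrite GE trCmx_block => /eq_block_mx[].
have adj : (diag_mx d)^t* *m G = G *m diag_mx e /\
           (diag_mx e)^t* *m G = G *m diag_mx d.
  split=> //; have := congr1 (fun M => M^t*) Ga.
  by rewrite /= !trCmx_mul trmxCK Gh.
have adjE f g : (diag_mx f)^t* *m G = G *m diag_mx g ->
    (diag_mx (lsubmx f))^t* *m K = K *m diag_mx (lsubmx g) /\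
    (diag_mx (lsubmx f))^t* *m U = U *m diag_mx (rsubmx g).
  rewrite GE -{1}[f]hsubmxK -{1}[g]hsubmxK !diag_mx_row trCmx_block !trCmx0.
  by rewrite !mulmx_block !(mul0mx, mulmx0, addr0, add0r) => /eq_block_mx[].
pose S : 'M[C]_(2 + k) := block_mx 1%:M (- (invmx K *m U)) 0 1%:M.
have comm f g : (diag_mx f)^t* *m G = G *m diag_mx g ->
    (diag_mx g)^t* *m G = G *m diag_mx f -> diag_mx f *m S = S *m diag_mx f.
  move=> /adjE[_ _] /adjE[hK' hU'].
  rewrite -[f]hsubmxK diag_mx_row /S !mulmx_block.
  rewrite !(mul0mx, mulmx0, addr0, add0r, mul1mx, mulmx1).
  congr block_mx; rewrite mulmxN mulNmx -mulmxA -hU'; congr (- _).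
  by apply: (can_inj (mulKmx Ku)); rewrite !mulmxA -hK' mulmxV // mul1mx mulmxK.
exists S, K, (drsubmx G - U^t* *m invmx K *m U), C0, d, e; case: adj => a1 a2.
split=> //; [|exact: comm a1 a2|exact: comm a2 a1|].
  by rewrite unitmxE det_ublock !det1 mulr1 unitr1.
rewrite [in LHS]GE /S trCmx_block !trCmx0 !trCmx_scalar conjC1 !mulmx_block.
rewrite !(mul0mx, mulmx0, addr0, add0r, mul1mx, mulmx1).
have VE : (- (invmx K *m U))^t* = - (U^t* *m invmx K).
  by rewrite linearN /= map_mxN trCmx_mul trmx_inv map_invmx Kh.
rewrite VE mulmxN mulmxA mulmxV // mul1mx addNr.
rewrite mulNmx mulmxKV // addNr mul0mx add0r.
by rewrite mulNmx addrC.
Qed.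

(** Any two basis vectors can be moved to the front. *)
Lemma splits_plane_pair k (G : 'M[C]_(2 + k)) d e i j :
  eigen_gram G d e -> i != j ->
  (forall K : 'M[C]_2, K 0 0 = G i i -> K 0 1 = G i j -> K 1 0 = G j i ->
    K 1 1 = G j j -> exists C0, C0^t* *m K *m C0 = flip_mx 2) ->
  splits_plane G d e.
Proof.
move=> GG ij hK.
have [s [s0 s1]] := @perm_through _ (lshift k (0 : 'I_2)) (lshift k 1) i j isT ij.
have dS := diag_mx_perm s d; have eS := diag_mx_perm s e.
have Su : perm_mx s^-1 \in @unitmx C (2 + k) by rewrite unitmx_perm.
apply: (splits_plane_congr Su dS eS).
set G' := _ *m _ *m _; have GE : G' = row_perm s (col_perm s G) by exact: gram_perm.
have [C0 C0E] : exists C0, C0^t* *m ulsubmx G' *m C0 = flip_mx 2.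
  by apply: hK; rewrite GE !mxE ?s0 ?s1.
by apply: splits_plane_lead C0E _; apply: eigen_gram_congr dS eS.
Qed.

(** Two isotropic vectors become a hyperbolic pair when the second one is divided
    by their product. *)
Lemma isotropic_plane (K : 'M[C]_2) : K 0 0 = 0 -> K 1 1 = 0 ->
  K 0 1 != 0 -> K 1 0 = (K 0 1)^* -> exists C0, C0^t* *m K *m C0 = flip_mx 2.
Proof.
move=> K00 K11 K01 K10.
exists (diag_mx (\row_j (if j == 0 then 1 else (K 0 1)^-1))).
rewrite tr_diag_mx map_diag_mx mul_mx_diag mul_diag_mx.
apply/matrixP => i j; rewrite !mxE.
case: (unliftP 0 i) => [i'|] ->; case: (unliftP 0 j) => [j'|] ->; rewrite ?ord1.
- rewrite /= (_ : lift 0 0 = 1 :> 'I_2) ?K11 ?mulr0 ?mul0r //; exact: val_inj.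
- rewrite /= (_ : lift 0 0 = 1 :> 'I_2) ?K10 ?mulr1 //; last exact: val_inj.
  by rewrite fmorphV mulVf // conjC_eq0.
- rewrite /= (_ : lift 0 0 = 1 :> 'I_2); last exact: val_inj.
  by rewrite conjC1 mul1r mulfV.
by rewrite K00 /= conjC1 mulr0 mul0r.
Qed.

(** For orthogonal [u], [v] with [[u, u] = a^2 / 2] and [[v, v] = - b^2 / 2], the
    vectors [u / a + v / b] and [u / a - v / b] are a hyperbolic pair. *)
Lemma indefinite_plane (K : 'M[C]_2) : 0 < K 0 0 -> K 1 1 < 0 ->
  K 0 1 = 0 -> K 1 0 = 0 -> exists C0, C0^t* *m K *m C0 = flip_mx 2.
Proof.
move=> K00 K11 K01 K10.
pose a := sqrtC (2 * K 0 0); pose b := sqrtC (2 * - K 1 1).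
have a0 : 0 < a by rewrite sqrtC_gt0 mulr_gt0 ?ltr0n.
have b0 : 0 < b by rewrite sqrtC_gt0 mulr_gt0 ?ltr0n ?oppr_gt0.
have aE : K 0 0 = a ^+ 2 / 2 by rewrite sqrtCK mulrAC mulfV ?pnatr_eq0 ?mul1r.
have bE : K 1 1 = - (b ^+ 2 / 2).
  by rewrite sqrtCK mulrAC mulfV ?pnatr_eq0 ?mul1r ?opprK.
pose C0 : 'M[C]_2 :=
  \matrix_(i, j) (if i == 0 then a^-1 else if j == 0 then b^-1 else - b^-1).
have C0r : C0^t* = C0^T.
  apply/matrixP => i j; rewrite !mxE; apply: CrealP.
  have ar : a \is Num.real by rewrite gtr0_real.
  have br : b \is Num.real by rewrite gtr0_real.
  by do 2?case: ifP => _; rewrite ?realN realV.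
exists C0; rewrite C0r; apply/matrixP => i j.
rewrite !(mxE, big_ord_recl, big_ord0) /=.
rewrite (_ : lift 0 0 = 1 :> 'I_2) //; last exact: val_inj.
rewrite K01 K10 aE bE !mulr0 !addr0 !add0r.
have an0 : a != 0 by rewrite gt_eqF.
have bn0 : b != 0 by rewrite gt_eqF.
case: (unliftP 0 i) => [i'|] ->; case: (unliftP 0 j) => [j'|] ->;
  rewrite ?ord1 /= ?[_ == rev_ord _]/(_ == _ :> nat) /=; field;
  rewrite ?an0 ?bn0 //.
Qed.

(** An entry [G a b] can be nonzero only if [conj (d a) = e b], so [v_i] is
    isotropic; nondegeneracy supplies a [v_j] not orthogonal to it, and the same
    rule shows that [v_j] is isotropic too. *)
Lemma splits_plane_isotropic k (G : 'M[C]_(2 + k)) d e i :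
  eigen_gram G d e -> (d 0 i)^* != e 0 i -> splits_plane G d e.
Proof.
move=> GG di; have [Gh Gu _ _] := GG.
have entry a b : G a b != 0 -> (d 0 a)^* = e 0 b by apply: eigen_gram_entry GG.
have Gii : G i i = 0 by apply: contra_neq_eq di => /entry.
have [j Gij] : exists j, G i j != 0.
  apply/existsP; apply: contraLR Gu; rewrite negb_exists => /forallP G0.
  suff r0 : row i G = 0.
    by rewrite -row_free_unit; apply/row_freePn; exists i; rewrite r0 sub0mx.
  by apply/rowP => j; rewrite !mxE; apply/eqP; rewrite -[_ == _]negbK G0.
have Gji : G j i != 0 by rewrite (eigen_gram_conj _ _ GG) conjC_eq0.
have Gjj : G j j = 0.
  apply: contra_neq_eq di => /entry dj.
  by rewrite (entry _ _ Gij) -dj (entry _ _ Gji).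
have ij : i != j by apply: contraNneq Gij => <-; rewrite Gii.
apply: (splits_plane_pair GG ij) => K K00 K01 K10 K11.
apply: isotropic_plane; rewrite ?K00 ?K11 ?K01 ?K10 //.
exact: eigen_gram_conj GG.
Qed.

(** Commuting matrices are unitarily trigonalizable together, and a triangular
    matrix whose conjugate transpose is triangular on the same side is
    diagonal. *)
Lemma unitary_codiag n (G : 'M[C]_n) (d : 'rV[C]_n) :
  G^t* = G -> diag_mx d *m G = G *m diag_mx d ->
  (diag_mx d)^t* *m G = G *m (diag_mx d)^t* ->
  exists S g d' e', [/\ S \in unitmx, S^t* *m G *m S = diag_mx g,
    diag_mx d *m S = S *m diag_mx d' & (diag_mx d)^t* *m S = S *m diag_mx e'].
Proof.
set D := diag_mx d => Gh DG DhG.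
have [|P Pu /and4P[/is_trig_mxP tG /is_trig_mxP tD /is_trig_mxP tDh _]] :=
    @cotrigonalization _ n [:: G; D; D^t*].
  have DD : comm_mx D (D^t*).
    by rewrite /comm_mx /D tr_diag_mx map_diag_mx diag_mxC.
  move=> A B; rewrite !inE => /or3P[]/eqP-> /or3P[]/eqP-> //;
    by apply: comm_mx_sym.
pose S := P^t*; have SP : S^t* = P by rewrite trmxCK.
have cE M : conjmx P M = S^t* *m M *m S by rewrite conjymx // SP.
have PS : P *m S = 1%:M by apply/unitarymxP.
have SP1 : S *m P = 1%:M by apply: mulmx1C.
have adj M : conjmx P (M^t*) = (conjmx P M)^t*.
  by rewrite !cE !trCmx_mul trmxCK mulmxA.
have diagP M : (forall i j : 'I_n, (i < j)%N -> conjmx P M i j = 0) ->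
    (forall i j : 'I_n, (i < j)%N -> conjmx P (M^t*) i j = 0) ->
    exists g, conjmx P M = diag_mx g.
  move=> t1 t2; apply/diag_mxP/is_diag_mxP => i j; case: ltngtP => // h _.
    exact: t1.
  by apply: (can_inj conjCK); have := t2 _ _ h; rewrite adj !mxE conjC0.
have [g gE] : exists g, conjmx P G = diag_mx g by apply: diagP; rewrite ?Gh.
have [d' dE] : exists g, conjmx P D = diag_mx g by apply: diagP.
have [e' eE] : exists g, conjmx P (D^t*) = diag_mx g.
  by apply: diagP; rewrite ?trmxCK.
exists S, g, d', e'; split.
- by have [] := mulmx1_unit PS.
- by rewrite -cE.
- by rewrite -dE cE SP !mulmxA SP1 mul1mx.
by rewrite -eE cE SP !mulmxA SP1 mul1mx.
Qed.

(** The inertia bounds are smaller than the dimension, so they exclude that all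
    the real numbers [g i] have the same sign. *)
Lemma splits_plane_diag k (g d e : 'rV[C]_(2 + k)) :
  eigen_gram (diag_mx g) d e -> splits_plane (diag_mx g) d e.
Proof.
move=> GG; have [_ Gu [Gp Gn] _] := GG.
have g_neq0 i : g 0 i != 0.
  by move: Gu; rewrite unitmxE det_diag unitfE => /prodf_neq0/(_ i isT).
have g_real i : g 0 i \is Num.real.
  apply/CrealP; have := eigen_gram_conj i i GG.
  by rewrite !mxE eqxx !mulr1n => <-.
have index1 N (h : 'rV[C]_(2 + k)) : pos_index_le N (diag_mx h) ->
    (forall i, 0 < h 0 i) -> (2 + k <= N)%N.
  move=> hN h0; apply: (hN _ 1%:M).
  by rewrite trCmx_scalar conjC1 mul1mx mulmx1; apply: posdef_diag.
have [i gi] : exists i, 0 < g 0 i.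
  apply/existsP; apply: contraT; rewrite negb_exists => /forallP g0.
  have : (2 + k <= (2 + k)./2)%N.
    apply: (index1 _ (- g)); rewrite ?raddfN // => i.
    rewrite mxE oppr_gt0 lt_neqAle g_neq0 /= real_leNgt ?real0 //; exact: g0.
  by rewrite -divn2; lia.
have [j gj] : exists j, g 0 j < 0.
  apply/existsP; apply: contraT; rewrite negb_exists => /forallP g0.
  have : (2 + k <= uphalf (2 + k))%N.
    apply: (index1 _ g) => // j.
    rewrite lt_neqAle eq_sym g_neq0 /= real_leNgt ?real0 //; exact: g0.
  by lia.
have ij : i != j by apply: contraTneq gi => ->; rewrite lt_gtF.
apply: (splits_plane_pair GG ij) => K; rewrite !mxE !eqxx [j == i]eq_sym (negPf ij).
by rewrite !mulr1n !mulr0n => K00 K01 K10 K11; apply: indefinite_plane;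
  rewrite ?K00 ?K01 ?K10 ?K11.
Qed.

Lemma splits_planeP k (G : 'M[C]_(2 + k)) d e :
  eigen_gram G d e -> splits_plane G d e.
Proof.
move=> GG; have [/forallP de|] := boolP [forall i, (d 0 i)^* == e 0 i]; last first.
  by case/forallPn=> i; apply: splits_plane_isotropic.
have eE : diag_mx e = (diag_mx d)^t*.
  rewrite tr_diag_mx map_diag_mx; congr diag_mx; apply/rowP => i.
  by rewrite mxE; apply/esym/eqP/de.
have [Gh _ _ Ga] := GG; rewrite eE in Ga.
have [] := unitary_codiag Gh _ Ga.
  by have /= := congr1 (fun M => M^t*) Ga; rewrite !trCmx_mul trmxCK Gh => ->.
move=> S [g [d' [e' [Su SG dS eS]]]]; rewrite -eE in eS.
apply: (splits_plane_congr Su dS eS); rewrite SG.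
by apply: splits_plane_diag; rewrite -SG; apply: eigen_gram_congr dS eS.
Qed.

(** The bound [1./2 = 0] on negative subspaces makes the remaining vector
    positive, so that it can be normalized. *)
Lemma X_reducible1 (G : 'M[C]_1) d e : eigen_gram G d e ->
  X_reducible G (diag_mx d).
Proof.
move=> GG; have [_ Gu [_ Gn] _] := GG.
have g0 : 0 < G 0 0.
  have gr : G 0 0 \is Num.real.
    by apply/CrealP; rewrite -(eigen_gram_conj _ _ GG).
  have gn0 : G 0 0 != 0 by move: Gu; rewrite unitmxE det_mx11 unitfE.
  rewrite lt_neqAle eq_sym gn0 /= real_leNgt ?real0 //; apply/negP => g0.
  suff : (1 <= 0)%N by [].
  apply: (Gn _ 1%:M); rewrite trCmx_scalar conjC1 mul1mx mulmx1.
  rewrite (_ : - G = diag_mx (const_mx (- G 0 0))).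
    by apply: posdef_diag => i; rewrite mxE oppr_gt0.
  by apply/matrixP => i j; rewrite !ord1 !mxE.
exists ((sqrtC (G 0 0))^-1)%:M, (diag_mx d); split.
- apply/matrixP => i j; rewrite !ord1 trCmx_scalar mul_mx_scalar mul_scalar_mx.
  rewrite !mxE /= geC0_conj ?invr_ge0 ?sqrtC_ge0 ?ltW //.
  by rewrite mulrA -expr2 exprVn sqrtCK mulVf ?gt_eqF.
- by rewrite scalar_mxC.
by apply/X_formP => i j; rewrite !ord1 eqxx.
Qed.

Lemma eigen_gram_X_reducible n (G : 'M[C]_n) d e :
  eigen_gram G d e -> X_reducible G (diag_mx d).
Proof.
elim/ltn_ind: n => -[|[|k]] IH in G d e *.
- by move=> _; exists 1%:M, (diag_mx d); split;
    [apply/matrixP => -[] | apply/matrixP => -[] | apply/X_formP => -[]].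
- exact: X_reducible1.
move=> GG; rewrite -[k.+2]/(2 + k)%N in G d e GG *.
have [S [K [M [C0 [d' [e' [Su dS eS GE KE]]]]]]] := splits_planeP GG.
apply: (X_reducible_congr dS); have GG' := eigen_gram_congr GG Su dS eS.
rewrite GE in GG' *; rewrite -[d']hsubmxK diag_mx_row.
apply: (X_reducible_block _ KE).
by apply: IH (eigen_gram_drsub KE GG').
Qed.

(** * Diagonalizable normal matrices *)

Lemma starE n (A : 'M[C]_n) : star A = flip_mx n *m A^t* *m flip_mx n.
Proof. by rewrite /star invmx_flip. Qed.

Lemma flip_mx_unit n : flip_mx n \in @unitmx C n.
Proof. by case/mulmx1_unit: (@flip_mxK C n). Qed.

Lemma diagonalizable_star n (A : 'M[C]_n) :
  diagonalizable A -> diagonalizable (star A).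
Proof.
case=> P Pu /diagonalizable_forPex[d /(simmxP Pu) PA].
have Ptu : P^t* \in unitmx by rewrite map_unitmx unitmx_tr.
pose Q := invmx (P^t*) *m flip_mx n.
have Qu : Q \in unitmx by rewrite unitmx_mul unitmx_inv Ptu flip_mx_unit.
have adjP : invmx (P^t*) *m A^t* = (diag_mx d)^t* *m invmx (P^t*).
  apply: (can_inj (mulmxK Ptu)).
  by rewrite mulmxKV // -mulmxA -trCmx_mul PA trCmx_mul mulKmx.
exists Q => //; apply/diagonalizable_forPex; exists (map_mx Num.conj d).
apply/(simmxP Qu); rewrite starE /Q !mulmxA -[_ *m flip_mx n *m flip_mx n]mulmxA.
by rewrite flip_mxK mulmx1 adjP tr_diag_mx map_diag_mx.
Qed.

Theorem flip_normal_X_form n (A : 'M[C]_n) :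
  diagonalizable A -> flip_normal A ->
  exists P : 'M[C]_n,
    [/\ P \in unitmx, perplectic P & X_form (star P *m A *m P)].
Proof.
move=> Ad An; pose R : 'M[C]_n := flip_mx n.
have [|P Pu /and3P[]] := proj1 (codiagonalizableP [:: A; star A]).
  have sAd := diagonalizable_star Ad.
  split=> [M N|M]; rewrite !inE => /orP[]/eqP->; last exact: sAd; last exact: Ad.
    by move=> /orP[]/eqP->.
  by move=> /orP[]/eqP->.
move=> /diagonalizable_forPex[d /(simmxP Pu) dA].
move=> /diagonalizable_forPex[e /(simmxP Pu) eA] _.
pose S := invmx P; have Su : S \in unitmx by rewrite unitmx_inv.
(* The rows of [P] are left eigenvectors; the columns of [S] are the basis. *)
have toS M f : P *m M = diag_mx f *m P -> M *m S = S *m diag_mx f.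
  move=> h; apply: (can_inj (mulKmx Pu)); rewrite mulmxA h mulmxK //.
  by rewrite mulKVmx.
have {}dA := toS _ _ dA; have {}eA := toS _ _ eA.
have GG : eigen_gram (S^t* *m R *m S) d e.
  split.
  - by rewrite !trCmx_mul trmxCK trCmx_flip mulmxA.
  - by rewrite !unitmx_mul Su map_unitmx unitmx_tr Su flip_mx_unit.
  - exact/split_inertia_congr/split_inertia_flip.
  rewrite !mulmxA -trCmx_mul -dA trCmx_mul -!mulmxA -eA starE.
  by rewrite !mulmxA -[_ *m R *m flip_mx n]mulmxA flip_mxK mulmx1.
have [T [B [TG dT XB]]] := eigen_gram_X_reducible GG.
have PG : (S *m T)^t* *m R *m (S *m T) = R by rewrite trCmx_mul -[RHS]TG !mulmxA.
have starP : star (S *m T) *m (S *m T) = 1%:M.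
  by rewrite starE -!(mulmxA (flip_mx n)) PG flip_mxK.
have AP : A *m (S *m T) = S *m T *m B by rewrite mulmxA dA -!mulmxA dT.
exists (S *m T); split=> //; first by case/mulmx1_unit: starP.
by rewrite -mulmxA AP mulmxA starP mul1mx.
Qed.

End FlipNormal.

Theorem theorem5 (R : realType) (n : nat) (A : 'M[R[i]]_n)
    (A_diag : diagonalizable A) (A_normal : flip_normal A) :
  exists P : 'M[R[i]]_n,
    [/\ P \in unitmx, perplectic P & X_form (star P *m A *m P)].
Proof. exact: flip_normal_X_form. Qed.
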